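(* Let $m\geqslant 7$ be an odd integer. Whatever the choice of $\alpha\in\overline{\mathbb F}_2^{\ast}$, the polynomial $L_\alpha(x^m)$ has distinct critical values if and only if the following condition is satisfied: for $\zeta_1$ and $\zeta_2$ in $\overline{\mathbb F}_2\setminus\{1\}$, the equalities $$\zeta_1^{m-1}=\zeta_2^{m-1}=\left(\frac{1+\zeta_1}{1+\zeta_2}\right)^{m-1}=1$$ imply $\zeta_1=\zeta_2$ or $\zeta_1=\zeta_2^{-1}$.
   Context: For $f\in\overline{\mathbb F}_2[x]$ and $\alpha\in\overline{\mathbb F}_2^{\ast}$, put $D_\alpha f(x)=f(x+\alpha)+f(x)$, and let $L_\alpha f$ denote the unique polynomial $g\in\overline{\mathbb F}_2[x]$ such that $g(x(x+\alpha))=D_\alpha f(x)$. A polynomial $g\in\overline{\mathbb F}_2[x]$ is said to have distinct critical values if for all $\tau,\eta\in\overline{\mathbb F}_2$, $g'(\tau)=g'(\eta)=0$ and $g(\tau)=g(\eta)$ imply $\tau=\eta$. *)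

(* Defs.v *)
From mathcomp Require Import all_boot all_order all_algebra.

Set Implicit Arguments.
Unset Strict Implicit.
Unset Printing Implicit Defensive.

Import GRing.Theory.
Local Open Scope ring_scope.

Definition Dpoly (K : fieldType) (alpha : K) (f : {poly K}) : {poly K} :=
  (f \Po ('X + alpha%:P)) + f.

Lemma pchar2_of_F2 (K : fieldType) (iota : {rmorphism 'F_2 -> K}) :
  2%N \in [pchar K].
Proof.
rewrite inE /=; apply/eqP; rewrite -(rmorph_nat iota).
by rewrite [X in iota X](_ : _ = 0) ?rmorph0 //; apply: val_inj.
Qed.

Lemma shift_invariant_comp (K : fieldType) (charK : 2%N \in [pchar K])
    (alpha : K) (alpha_neq0 : alpha != 0) (h : {poly K}) :
  h \Po ('X + alpha%:P) = h ->
  exists g : {poly K}, g \Po ('X * ('X + alpha%:P)) = h.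
Proof.
set q := 'X * _.
have sz_q : size q = 3.
  by rewrite /q mulrC size_mulX ?size_XaddC // -size_poly_eq0 size_XaddC.
have q_neq0 : q != 0 by rewrite -size_poly_eq0 sz_q.
have qK : q \Po ('X + alpha%:P) = q.
  rewrite /q comp_polyM comp_polyD comp_polyX comp_polyC -addrA -polyCD.
  by rewrite addrr_pchar2 // polyC0 addr0 mulrC.
elim: {h}(size h) {-2}h (leqnn (size h)) => [|n IHn] h.
  by rewrite leqn0 size_poly_eq0 => /eqP-> _; exists 0; rewrite comp_poly0.
move=> sz_h hK.
have h_alpha : h.[alpha] = h.[0].
  by rewrite -[in RHS]hK horner_comp !hornerE.
have q_dvd : q %| h - (h.[0])%:P.
  have -> : q = ('X - 0%:P) * ('X - alpha%:P).
    rewrite /q polyC0 subr0; congr (_ * (_ + _)).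
    by rewrite -polyCN oppr_pchar2.
  rewrite Gauss_dvdp; last by rewrite coprimep_XsubC root_XsubC.
  by rewrite !dvdp_XsubCl !rootE !hornerE h_alpha subrr eqxx.
have [k def_k] := dvdpP _ _ q_dvd.
have kK : k \Po ('X + alpha%:P) = k.
  apply: (mulIf q_neq0); rewrite -{1}qK -comp_polyM -def_k.
  by rewrite comp_polyB hK comp_polyC.
have sz_k : (size k <= n)%N.
  have [->|k_neq0] := eqVneq k 0; first by rewrite size_poly0.
  have : (size (k * q)%R <= n.+1)%N.
    rewrite -def_k (leq_trans (size_polyD _ _)) // size_polyN geq_max sz_h.
    by rewrite (leq_trans (size_polyC_leq1 _)).
  by rewrite size_mul // sz_q addn3 /= => /ltnW.
have [g def_g] := IHn k sz_k kK.
exists (g * 'X + (h.[0])%:P).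
by rewrite comp_poly_MXaddC def_g -def_k subrK.
Qed.

Lemma Lpoly_exists (K : fieldType) (charK : 2%N \in [pchar K])
    (alpha : K) (alpha_neq0 : alpha != 0) (f : {poly K}) :
  exists g : {poly K}, g \Po ('X * ('X + alpha%:P)) == Dpoly alpha f.
Proof.
have [|g def_g] := shift_invariant_comp charK alpha_neq0 (h := Dpoly alpha f).
  rewrite /Dpoly comp_polyD -comp_polyA comp_polyD comp_polyX comp_polyC.
  by rewrite -addrA -polyCD addrr_pchar2 // polyC0 addr0 comp_polyXr addrC.
by exists g; apply/eqP.
Qed.

(* The proofs of characteristic 2 and of alpha != 0 guarantee existence of the
   polynomial; by LpolyP it is the only one with this property. *)
Definition Lpoly (K : fieldType) (charK : 2%N \in [pchar K])
    (alpha : K) (alpha_neq0 : alpha != 0) (f : {poly K}) : {poly K} :=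
  xchoose (Lpoly_exists charK alpha_neq0 f).

Lemma LpolyP (K : fieldType) (charK : 2%N \in [pchar K])
    (alpha : K) (alpha_neq0 : alpha != 0) (f g : {poly K}) :
  g \Po ('X * ('X + alpha%:P)) = Dpoly alpha f <->
  g = Lpoly charK alpha_neq0 f.
Proof.
have LE := eqP (xchooseP (Lpoly_exists charK alpha_neq0 f)).
split=> [def_g|->]; last exact: LE.
apply/eqP; rewrite -subr_eq0 -(@comp_poly_eq0 _ _ ('X * ('X + alpha%:P))).
  by rewrite comp_polyB def_g LE subrr.
by rewrite mulrC size_mulX ?size_XaddC // -size_poly_eq0 size_XaddC.
Qed.

Definition distinct_critical_values (K : fieldType) (g : {poly K}) : Prop :=
  forall tau eta : K,
    g^`().[tau] = 0 -> g^`().[eta] = 0 -> g.[tau] = g.[eta] -> tau = eta.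

(* Main.v *)
Require Import Defs.
From mathcomp Require Import all_boot all_order all_algebra.
From mathcomp Require Import ring.

Set Implicit Arguments.
Unset Strict Implicit.
Unset Printing Implicit Defensive.

Import GRing.Theory.
Local Open Scope ring_scope.

(** Put g = L_alpha(x^m).  Each tau other than 0 (which is not critical) is
    x (x + alpha) with x != 0, alpha.  In the coordinate
    zeta = (x + alpha) / x != 1 one has x = alpha / (1 + zeta) and
    tau = alpha^2 zeta / (1 + zeta)^2.
    Differentiating g(x (x + alpha)) = (x + alpha)^m + x^m shows that
    g'(tau) = 0 iff zeta^(m-1) = 1, in which case g(tau) = alpha x^(m-1);
    and tau determines zeta up to inversion. *)

Lemma pchar2_addr_neq0 (K : fieldType) (charK : 2%N \in [pchar K]) (z : K) :
  (1 + z != 0) = (z != 1).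
Proof. by rewrite -{1}(oppr_pchar2 charK z) subr_eq0 eq_sym. Qed.

Definition Lpoint (K : fieldType) (alpha zeta : K) : K :=
  alpha ^+ 2 * zeta / (1 + zeta) ^+ 2.

(** After clearing denominators, the difference of the two sides factors as
    [alpha ^+ 2 * (z1 - z2) * (1 - z1 * z2)]. *)
Lemma Lpoint_inj (K : fieldType) (alpha z1 z2 : K) :
  alpha != 0 -> 1 + z1 != 0 -> 1 + z2 != 0 -> z2 != 0 ->
  Lpoint alpha z1 = Lpoint alpha z2 <-> z1 = z2 \/ z1 = z2^-1.
Proof.
move=> a0 z1n z2n z20; rewrite /Lpoint; split=> [/eqP|[->|->]//].
  rewrite eqr_div ?expf_neq0 // -subr_eq0.
  have -> : alpha ^+ 2 * z1 * (1 + z2) ^+ 2 - alpha ^+ 2 * z2 * (1 + z1) ^+ 2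
     = alpha ^+ 2 * ((z1 - z2) * (1 - z1 * z2)) by ring.
  rewrite mulf_eq0 expf_eq0 (negPf a0) /= mulf_eq0 !subr_eq0.
  case/orP=> /eqP z12; [by left | right].
  by rewrite -[RHS]mul1r z12 mulfK.
by field; rewrite z20 z2n.
Qed.

Section LpolyXn.

Variables (K : fieldType) (charK : 2%N \in [pchar K]).
Variables (m : nat) (m_odd : odd m) (alpha : K) (alpha_neq0 : alpha != 0).

Local Notation g := (Lpoly charK alpha_neq0 'X^m).

Lemma Lpoly_comp (f : {poly K}) :
  Lpoly charK alpha_neq0 f \Po ('X * ('X + alpha%:P)) = Dpoly alpha f.
Proof. exact/(LpolyP charK alpha_neq0). Qed.

Lemma horner_LpolyXn (x : K) :
  g.[x * (x + alpha)] = (x + alpha) ^+ m + x ^+ m.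
Proof.
have := congr1 (fun p => p.[x]) (Lpoly_comp 'X^m).
by rewrite /Dpoly horner_comp hornerD horner_comp !hornerE.
Qed.

(** Chain rule: in characteristic 2, [x * (x + alpha)] has derivative [alpha], and since [m] is odd,
    ['X^m] has derivative ['X^(m.-1)]. *)
Lemma horner_deriv_LpolyXn (x : K) :
  g^`().[x * (x + alpha)] * alpha = (x + alpha) ^+ m.-1 + x ^+ m.-1.
Proof.
have m1 : m%:R = 1 :> K.
  by rewrite -[m]odd_double_half m_odd natrD -muln2 natrM
     (pcharf0 charK) mulr0 addr0.
have dXm : ('X^m : {poly K})^`() = 'X^(m.-1).
  by rewrite derivXn -scaler_nat m1 scale1r.
have dXa : ('X + alpha%:P)^`() = 1.
  by rewrite derivD derivX derivC addr0.
have := congr1 (fun p => p^`().[x]) (Lpoly_comp 'X^m).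
rewrite /Dpoly derivD !deriv_comp dXm derivM dXa derivX mul1r !mulr1.
rewrite hornerM hornerD !horner_comp !hornerE => <-.
by rewrite addrAC addrr_pchar2 // add0r.
Qed.

Lemma LpointE (z : K) : z != 1 ->
  Lpoint alpha z = alpha / (1 + z) * (alpha / (1 + z) + alpha) /\
  alpha / (1 + z) + alpha = z * (alpha / (1 + z)).
Proof.
move=> z1; have z1n : 1 + z != 0 by rewrite pchar2_addr_neq0.
have E : alpha / (1 + z) + alpha = z * (alpha / (1 + z)).
  rewrite -[in X in _ + X](mulfVK z1n alpha) mulrDr mulr1 addrA.
  by rewrite addrr_pchar2 // add0r mulrC.
by split=> //; rewrite E /Lpoint; field.
Qed.

(** With [x = alpha / (1 + z)] one has [x + alpha = z * x], so [alpha] times the derivative at the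
    point is [(z ^+ m.-1 + 1) * x ^+ m.-1], where [x] is nonzero. *)
Lemma crit_Lpoint (z : K) : z != 1 ->
  (g^`().[Lpoint alpha z] == 0) = (z ^+ m.-1 == 1).
Proof.
move=> z1; have [-> E] := LpointE z1.
rewrite -(inj_eq (mulIf alpha_neq0)) mul0r horner_deriv_LpolyXn E exprMn.
rewrite -[X in _ + X](oppr_pchar2 charK) -[X in _ - X]mul1r -mulrBl mulf_eq0.
rewrite subr_eq0 [X in _ || X](_ : _ = false) ?orbF //.
apply/negbTE/expf_neq0.
by rewrite mulf_neq0 ?invr_eq0 // pchar2_addr_neq0.
Qed.

Lemma crit_value_Lpoint (z : K) : z != 1 -> z ^+ m.-1 = 1 ->
  g.[Lpoint alpha z] = alpha * (alpha / (1 + z)) ^+ m.-1.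
Proof.
move=> z1 zm; have [-> E] := LpointE z1.
have mS : m = m.-1.+1 by case: (m) m_odd.
(* One factor is split off each [m]-th power: [x + alpha] and [x] have the same power of exponent
   [m.-1], and the split factors add up to [alpha]. *)
rewrite horner_LpolyXn mS !exprSr -mS.
have -> : (alpha / (1 + z) + alpha) ^+ m.-1 = (alpha / (1 + z)) ^+ m.-1.
  by rewrite E exprMn zm mul1r.
by rewrite -mulrDr addrAC addrr_pchar2 // add0r mulrC.
Qed.

(** The two critical values are [alpha ^+ m / (1 + z1) ^+ m.-1] and [alpha ^+ m / (1 + z2) ^+ m.-1],
    so they agree exactly when the denominators do. *)
Lemma crit_value_eq (z1 z2 : K) :
  z1 != 1 -> z2 != 1 -> z1 ^+ m.-1 = 1 -> z2 ^+ m.-1 = 1 ->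
  g.[Lpoint alpha z1] = g.[Lpoint alpha z2] <->
  ((1 + z1) / (1 + z2)) ^+ m.-1 = 1.
Proof.
move=> z1n z2n z1m z2m; rewrite !crit_value_Lpoint //.
have c1 : (1 + z1) ^+ m.-1 != 0 by rewrite expf_neq0 // pchar2_addr_neq0.
have c2 : (1 + z2) ^+ m.-1 != 0 by rewrite expf_neq0 // pchar2_addr_neq0.
rewrite !expr_div_n; split=> [/(mulfI alpha_neq0)|].
  move/(mulfI (expf_neq0 _ alpha_neq0))/invr_inj ->; exact: divff.
by move/divr1_eq->.
Qed.

End LpolyXn.

Lemma crit_LpolyXn_Lpoint (K : closedFieldType) (charK : 2%N \in [pchar K])
    (m : nat) (m_gt1 : (1 < m)%N) (m_odd : odd m)
    (alpha : K) (alpha_neq0 : alpha != 0) (tau : K) :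
  (Lpoly charK alpha_neq0 'X^m)^`().[tau] = 0 ->
  exists2 z, z != 1 & tau = Lpoint alpha z.
Proof.
move=> crit.
have [x /rootP] : exists x, root ('X * ('X + alpha%:P) - tau%:P) x.
  apply/closed_rootP.
  have szq : size ('X * ('X + alpha%:P)) = 3.
    by rewrite mulrC size_mulX ?size_XaddC // -size_poly_eq0 size_XaddC.
  rewrite size_polyDl szq // size_polyN.
  exact: leq_ltn_trans (size_polyC_leq1 _) _.
rewrite !hornerE => /eqP; rewrite subr_eq0 => /eqP def_tau.
(* If [x = 0], then [tau = 0], and the derivative identity gives [alpha ^+ m.-1 = 0]; here [1 < m]
   ensures that [0 ^+ m.-1] vanishes. *)
have x0 : x != 0.
  apply: contraTneq isT => x0.
  have := horner_deriv_LpolyXn charK m_odd alpha_neq0 x.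
  rewrite def_tau crit mul0r x0 add0r expr0n.
  case: (m) m_gt1 => [|[|k]] //= _ /eqP.
  by rewrite addr0 eq_sym expf_eq0 (negPf alpha_neq0) andbF.
have zE : 1 + (x + alpha) / x = alpha / x.
  by rewrite mulrDl divff // addrA addrr_pchar2 // add0r.
have z1 : (x + alpha) / x != 1.
  by rewrite -(pchar2_addr_neq0 charK) zE mulf_neq0 ?invr_eq0.
exists ((x + alpha) / x) => //.
rewrite -def_tau /Lpoint zE; field.
by rewrite x0.
Qed.

Theorem proposition3p11
  (K : closedFieldType) (iota : {rmorphism 'F_2 -> K})
  (algebraic_K : integralRange iota)
  (m : nat) (m_ge7 : (7 <= m)%N) (m_odd : odd m)
  (alpha : K) (alpha_neq0 : alpha != 0) :
  distinct_critical_values (Lpoly (pchar2_of_F2 iota) alpha_neq0 'X^m) <->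
  (forall zeta1 zeta2 : K,
     zeta1 != 1 -> zeta2 != 1 ->
     zeta1 ^+ (m - 1) = 1 -> zeta2 ^+ (m - 1) = 1 ->
     ((1 + zeta1) / (1 + zeta2)) ^+ (m - 1) = 1 ->
     zeta1 = zeta2 \/ zeta1 = zeta2^-1).
Proof.
have m_gt1 : (1 < m)%N by apply: leq_trans m_ge7.
have charK := pchar2_of_F2 iota.
(* The exponent is positive, so 0 is not a root of unity; this makes inversion of [zeta2] legitimate
   in [Lpoint_inj]. *)
have root_neq0 (z : K) : z ^+ m.-1 = 1 -> z != 0.
  apply: contra_eq_neq => ->; rewrite expr0n eq_sym.
  by case: (m) m_gt1 => [|[|k]] //= _; rewrite oner_eq0.
rewrite subn1; split=> [dcv z1 z2 z1n z2n z1m z2m z12|zP tau eta].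
  apply/(Lpoint_inj alpha_neq0);
    rewrite ?(pchar2_addr_neq0 charK) ?root_neq0 //.
  (* The root-of-unity conditions make both points critical, and the condition on the quotient makes
     their values equal. *)
  apply: dcv; try by apply/eqP; rewrite crit_Lpoint //; apply/eqP.
  exact/crit_value_eq.
move=> ct ce.
(* Conversely, both critical points are written in the [zeta] coordinate, which turns the hypotheses
   on [tau] and [eta] into the three equalities. *)
have [z1 z1n ?] := crit_LpolyXn_Lpoint m_gt1 m_odd ct; subst tau.
have [z2 z2n ?] := crit_LpolyXn_Lpoint m_gt1 m_odd ce; subst eta.
move/eqP: ct; rewrite crit_Lpoint // => /eqP z1m.
move/eqP: ce; rewrite crit_Lpoint // => /eqP z2m.
move/crit_value_eq=> /(_ m_odd z1n z2n z1m z2m) z12.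
apply/(Lpoint_inj alpha_neq0);
    rewrite ?(pchar2_addr_neq0 charK) ?root_neq0 //.
exact: zP.
Qed.
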